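(* Let $\mathsf{T}$ be a triangulation of the standard simplex $\Delta^{n-1}=\langle v_1,\ldots,v_n\rangle$ and let $\lambda_1,\ldots,\lambda_m$ be Sperner labelings of $\mathsf{T}$. (1) For any choice of positive integers $k_1,\ldots,k_m$ with $k_1+\cdots+k_m=m+n-1$, there exists a simplex $\sigma\in\mathsf{T}$ such that, for each $i\in[m]$, the labeling $\lambda_i$ uses at least $k_i$ distinct labels on the vertices of $\sigma$. (2) For any choice of positive integers $\ell_1,\ldots,\ell_n$ with $\ell_1+\cdots+\ell_n=m+n-1$, there exists a simplex $\tau\in\mathsf{T}$ such that, for each $j\in[n]$, the label $j$ is used on the vertices of $\tau$ by at least $\ell_j$ of the labelings $\lambda_1,\ldots,\lambda_m$.
   Context: A labeling $\lambda\colon V(\mathsf{T})\to[n]$ of the vertices of a triangulation $\mathsf{T}$ of $\Delta^{n-1}=\langle v_1,\ldots,v_n\rangle$ is a Sperner labeling if each vertex $v$ of $\mathsf{T}$ receives a label $j$ such that $v_j$ is a vertex of the minimal face of $\Delta^{n-1}$ containing $v$. *)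

(* Defs.v *)
From HB Require Import structures.
From mathcomp Require Import all_boot all_order all_algebra.
From mathcomp Require Import reals.
Set Implicit Arguments. Unset Strict Implicit. Unset Printing Implicit Defensive.
Import Order.TTheory GRing.Theory Num.Theory.
Local Open Scope ring_scope.

Section Triangulation.
Variables (R : realType) (n : nat).

(* Points of R^n are row vectors 'rV[R]_n; coordinate j of p is p 0 j.
   The vertex v_j of Delta^{n-1} is the standard basis vector delta_mx 0 j. *)

Definition in_std_simplex (p : 'rV[R]_n) : Prop :=
  (forall j, 0 <= p 0 j) /\ \sum_j p 0 j = 1.

Definition in_face (J : {set 'I_n}) (p : 'rV[R]_n) : Prop :=
  exists c : 'I_n -> R,
    [/\ forall j, 0 <= c j, forall j, j \notin J -> c j = 0,
        \sum_j c j = 1 & p = \sum_j c j *: (delta_mx 0 j : 'rV[R]_n)].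

Variable V : finType.

Definition in_conv (pos : V -> 'rV[R]_n) (s : {set V}) (x : 'rV[R]_n) : Prop :=
  exists c : V -> R,
    [/\ forall v, 0 <= c v, forall v, v \notin s -> c v = 0,
        \sum_v c v = 1 & x = \sum_v c v *: pos v].

Definition affinely_indep (pos : V -> 'rV[R]_n) (s : {set V}) : Prop :=
  forall c : V -> R, (forall v, v \notin s -> c v = 0) ->
    \sum_v c v = 0 -> \sum_v c v *: pos v = 0 -> forall v, c v = 0.

(* A triangulation of Delta^{n-1}: a geometric simplicial complex with
   vertex set V (positioned by pos), simplices T (given by their vertex
   sets), whose union is Delta^{n-1}. *)
Definition is_triangulation (pos : V -> 'rV[R]_n) (T : {set {set V}}) : Prop :=
  injective pos /\
  (forall v, in_std_simplex (pos v)) /\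
  (forall v, [set v] \in T) /\
  (forall s : {set V}, s \in T -> s != set0 /\ affinely_indep pos s) /\
  (forall s t : {set V}, s \in T -> t \subset s -> t != set0 -> t \in T) /\
  (forall x, in_std_simplex x -> exists2 s, s \in T & in_conv pos s x) /\
  (forall (s t : {set V}) x, s \in T -> t \in T -> in_conv pos s x -> in_conv pos t x ->
        in_conv pos (s :&: t) x).

(* Sperner labeling: each vertex v receives a label j such that v_j is a
   vertex of the minimal face of Delta^{n-1} containing v, i.e. j belongs to
   every face (index set J) containing v. *)
Definition sperner_labeling (pos : V -> 'rV[R]_n) (lam : V -> 'I_n) : Prop :=
  forall v (J : {set 'I_n}), in_face J (pos v) -> lam v \in J.

End Triangulation.

(* Main.v *)
Require Import Defs.
From HB Require Import structures.
From mathcomp Require Import all_boot all_order all_algebra.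
From mathcomp Require Import reals.
From mathcomp Require Import ring lra.
From mathcomp Require Import boolp classical_sets filter interval_inference.
From mathcomp Require Import topology normedtype sequences.
Import Order.TTheory GRing.Theory Num.Theory.
Local Open Scope ring_scope.
Set Implicit Arguments. Unset Strict Implicit. Unset Printing Implicit Defensive.

(** Extend a combination [\sum_i w_i e_(lam_i v)] of the labelings, with
    [\sum_i w_i = 1], piecewise linearly to the simplex. The extension [F] maps
    every face into the affine span of the same face, and it hits every point
    [y] of the simplex: label a point [p] by some [j] with [p_j != 0] and
    [y_j <= F(p)_j]. Sperner's lemma yields arbitrarily small simplices
    carrying all labels, and at a limit point [F(p)_j >= y_j] for all [j], so
    [F(p) = y].

    For (2), take [w_i = 1/m] and [y_j = (l_j - 1 + 1/n)/m]: the coordinates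
    [x_ij] of [lam_i] at [p] lie in [0, 1] and [\sum_i x_ij > l_j - 1], so at
    least [l_j] of them are nonzero. Part (1) is the same argument with the
    roles of rows and columns exchanged.

    Sperner's lemma is proved homologically. The cochain [det (e_(L t_i))] is a
    cocycle vanishing on the boundary, so its value on the simplex, which is 1,
    is unchanged by barycentric subdivision, which is chain homotopic to the
    identity. *)

(** * Cochains and barycentric subdivision *)

(** The simplicial coboundary on [s]: an alternating sum of [phi] over the lists with one entry of
    [s] dropped. The recursion splits off the term that drops the head. *)
Fixpoint cobd (E : Type) (A : zmodType) (s : seq E) (phi : seq E -> A) : A :=
  if s is x :: s' then phi s' - cobd s' (fun t => phi (x :: t)) else 0.

Section Coboundary.
Variables (E : eqType) (A : zmodType).
Implicit Types (s t : seq E) (phi psi : seq E -> A).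

Lemma eq_cobd s phi psi :
  (forall t, (size t).+1 = size s -> phi t = psi t) -> cobd s phi = cobd s psi.
Proof.
elim: s phi psi => //= x s IHs phi psi eq_phi; rewrite eq_phi //.
by congr (_ - _); apply: IHs => t st; apply: eq_phi; rewrite /= st.
Qed.

Lemma cobdB s phi psi :
  cobd s (fun t => phi t - psi t) = cobd s phi - cobd s psi.
Proof.
elim: s phi psi => [|x s IHs] phi psi /=; first by rewrite subr0.
by rewrite (IHs (fun t => phi (x :: t))) !opprD !opprK addrACA.
Qed.

Lemma cobd_cobd s phi : cobd s (fun t => cobd t phi) = 0.
Proof.
elim: s phi => //= x s IHs phi.
by rewrite (cobdB s phi) IHs subr0 subrr.
Qed.

Lemma cobd_neq0 s phi : cobd s phi != 0 ->
  exists t, [/\ (size t).+1 = size s, {subset t <= s} & phi t != 0].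
Proof.
elim: s phi => [|x s IHs] phi /=; first by rewrite eqxx.
have [phis0|phis _] := eqVneq (phi s) 0; last first.
  by exists s; split=> // y ys; rewrite inE ys orbT.
rewrite phis0 sub0r oppr_eq0 => /IHs[t [st ts phit]].
exists (x :: t); split=> //=; first by rewrite st.
by move=> y; rewrite !inE => /orP[->//|/ts ->]; rewrite orbT.
Qed.

End Coboundary.

Lemma cobdE (E : Type) (R : pzRingType) (s : seq E) (phi : seq E -> R) :
  cobd s phi = \sum_(i < size s) (-1) ^+ i * phi (take i s ++ drop i.+1 s).
Proof.
elim: s phi => [|x s IHs] phi /=; first by rewrite big_ord0.
rewrite big_ord_recl /= expr0 mul1r drop0 IHs -sumrN; congr (_ + _).
by apply: eq_bigr => i _; rewrite /bump /= exprS mulN1r mulNr.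
Qed.

(** * Subdivision as a chain map homotopic to the identity *)

Section Subdivision.
Variables (R : realFieldType) (E : lmodType R) (A : zmodType).
Implicit Types (s t : seq E) (phi psi : seq E -> A).

Definition bary s : E := (size s)%:R^-1 *: \sum_(x <- s) x.

(* Cochain-level transpose of barycentric subdivision: [sd phi s] is [phi]
   evaluated on the subdivided simplex [s], that is, on the cone from [bary s]
   over the subdivision of the boundary of [s]. The empty simplex is allowed
   (augmented complex). *)
Fixpoint sdr (k : nat) phi s : A :=
  if k is k'.+1 then cobd s (sdr k' (fun t => phi (bary s :: t))) else phi s.
Definition sd phi s := sdr (size s) phi s.

(* Cochain-level transpose of the homotopy [T s = bary s * (s - T (boundary s))]. *)
Fixpoint thr (k : nat) phi s : A :=
  if k is k'.+1 then
    phi (bary s :: s) - cobd s (thr k' (fun t => phi (bary s :: t)))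
  else 0.
Definition th phi s := thr (size s) phi s.

Lemma sd_rec s phi : (0 < size s)%N ->
  sd phi s = cobd s (sd (fun t => phi (bary s :: t))).
Proof.
case: s => // x s _; rewrite {1}/sd.
by apply: eq_cobd => t [st]; rewrite /sd st.
Qed.

Lemma th_rec s phi : (0 < size s)%N ->
  th phi s = phi (bary s :: s) - cobd s (th (fun t => phi (bary s :: t))).
Proof.
case: s => // x s _; rewrite {1}/th; congr (_ - _).
by apply: eq_cobd => t [st]; rewrite /th st.
Qed.

Lemma sdB s phi psi : sd (fun t => phi t - psi t) s = sd phi s - sd psi s.
Proof.
rewrite /sd; move: (size s) => k; elim: k s phi psi => //= k IHk s phi psi.
by rewrite -cobdB; apply: eq_cobd => t _; rewrite IHk.
Qed.

Lemma thB s phi psi : th (fun t => phi t - psi t) s = th phi s - th psi s.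
Proof.
rewrite /th; move: (size s) => k; elim: k s phi psi => [|k IHk] s phi psi /=.
  by rewrite subr0.
rewrite (@eq_cobd _ _ _ _ _ (fun t _ => IHk t _ _)) cobdB.
by rewrite !opprD !opprK addrACA.
Qed.

(** Dually, subdivision is a chain map: the boundary of a cone is its base minus the cone over the
    boundary of the base. By induction on the faces, the second term is a double coboundary and
    vanishes. *)
Lemma sd_cobd s phi : sd (fun t => cobd t phi) s = cobd s (sd phi).
Proof.
have [k] := ubnP (size s); elim: k => // k IHs in s phi * => /ltnSE-sz.
have [/size0nil-> //|s_gt0] := posnP (size s).
rewrite sd_rec //=.
rewrite (@eq_cobd _ _ _ _ _ (fun t _ => sdB t phi _)) cobdB.
rewrite [X in _ - X](@eq_cobd _ _ _ _ (fun t => cobd t (sd (fun u => phi (bary s :: u))))).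
  by rewrite cobd_cobd subr0.
by move=> t st; apply: IHs; rewrite st.
Qed.

(** Induction on the faces, applied to [phib]: the term [cobd t (th phib)] dies under a second
    coboundary, and the rest cancels against the recursions of [sd] and [th]. *)
Lemma sd_homotopy s phi :
  phi s - sd phi s = th (fun t => cobd t phi) s + cobd s (th phi).
Proof.
have [k] := ubnP (size s); elim: k => // k IHs in s phi * => /ltnSE-sz.
have [/size0nil->|s_gt0] := posnP (size s).
  by rewrite /th /sd /= subrr addr0.
pose phib t := phi (bary s :: t).
rewrite th_rec //=.
rewrite (@eq_cobd _ _ _ _ _ (fun t _ => thB t phi _)) cobdB.
rewrite [X in _ - (_ - X)](@eq_cobd _ _ _ _
    (fun t => phib t - sd phib t - cobd t (th phib))); last first.
  by move=> t st; rewrite (IHs t phib) ?addrK // st.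
rewrite (cobdB _ (fun t => phib t - sd phib t)) cobdB cobd_cobd subr0 -sd_rec //.
rewrite -/phib; move: (cobd s phib) (cobd s (th phi)) => c d.
by rewrite [- (d - _)]opprB [phi s - c + _]addrA subrK addrA subrK.
Qed.

End Subdivision.

Section Support.
Variables (R : realFieldType) (E : lmodType R) (A : zmodType).
Implicit Types (s t : seq E) (phi : seq E -> A) (K : E -> Prop).

(** A weak convexity, enough to keep every vertex of the subdivision of a simplex inside [K]. *)
Definition bary_closed K :=
  forall s, (0 < size s)%N -> {in s, forall p, K p} -> K (bary s).

Lemma sd_neq0 K s phi : bary_closed K -> {in s, forall p, K p} ->
  sd phi s != 0 ->
  exists t, [/\ size t = size s, {in t, forall p, K p} & phi t != 0].
Proof.
move=> Kb; have [k] := ubnP (size s); elim: k => // k IHk in s phi * => /ltnSE-sz Ks.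
have [/size0nil-> phi0|s_gt0] := posnP (size s); first by exists [::].
rewrite sd_rec // => /cobd_neq0[t [st ts]] /IHk[||u [su Ku phiu]].
- by rewrite st.
- by move=> p /ts /Ks.
exists (bary s :: u); split; rewrite //= ?su // => p.
by rewrite inE => /predU1P[->|/Ku //]; apply: Kb.
Qed.

Lemma th_neq0 K s phi : bary_closed K -> {in s, forall p, K p} ->
  th phi s != 0 ->
  exists t, [/\ size t = (size s).+1, {in t, forall p, K p} & phi t != 0].
Proof.
move=> Kb; have [k] := ubnP (size s); elim: k => // k IHk in s phi * => /ltnSE-sz Ks.
have [/size0nil->|s_gt0] := posnP (size s); first by rewrite /th /= eqxx.
have KC u : {in u, forall p, K p} -> {in bary s :: u, forall p, K p}.
  by move=> Ku p; rewrite inE => /predU1P[->|/Ku //]; apply: Kb.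
rewrite th_rec //; have [phis|phis _] := eqVneq (phi (bary s :: s)) 0; last first.
  by exists (bary s :: s); split=> //; apply: KC.
rewrite phis sub0r oppr_eq0 => /cobd_neq0[t [st ts]] /IHk[||u [su Ku phiu]].
- by rewrite st.
- by move=> p /ts /Ks.
by exists (bary s :: u); split; rewrite //= ?su ?st //; apply: KC.
Qed.

End Support.

(** * Mesh of the subdivision *)

Section Coordinates.
Variables (R : realFieldType) (n : nat).
Local Notation E := 'rV[R]_n.
Implicit Types (s t : seq E) (p c : E).

Lemma baryE s l : bary s 0 l = (size s)%:R^-1 * \sum_(p <- s) p 0 l.
Proof. by rewrite /bary mxE summxE. Qed.

Lemma bary_coord_le s l a : (0 < size s)%N ->
  {in s, forall p, p 0 l <= a} -> bary s 0 l <= a.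
Proof.
move=> s_gt0 sa; rewrite baryE ler_pdivrMl ?ltr0n //.
rewrite big_seq; apply: le_trans (ler_sum _ sa) _.
by rewrite -big_seq big_const_seq count_predT iter_addr_0 mulr_natl.
Qed.

Lemma bary_coord_ge s l a : (0 < size s)%N ->
  {in s, forall p, a <= p 0 l} -> a <= bary s 0 l.
Proof.
move=> s_gt0 sa; rewrite baryE ler_pdivlMl ?ltr0n //.
rewrite [leRHS]big_seq; apply: le_trans (ler_sum _ sa).
by rewrite -big_seq big_const_seq count_predT iter_addr_0 mulr_natl.
Qed.

Lemma bary_closed_coord0 j : bary_closed (fun p : E => p 0 j = 0).
Proof.
move=> s s0 sK; apply/eqP; rewrite eq_le.
by rewrite bary_coord_le ?bary_coord_ge // => p /sK ->.
Qed.

Lemma bary_closed_ball c (d : R) :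
  bary_closed (fun p : E => forall l, `|c 0 l - p 0 l| <= d).
Proof.
move=> s s0 sK l; rewrite ler_distlC.
by rewrite bary_coord_le ?bary_coord_ge // => p /sK/(_ l);
  rewrite ler_distlC => /andP[].
Qed.

Definition diam_le (d : R) s :=
  {in s &, forall p p', forall l, `|p 0 l - p' 0 l| <= d}.

(** [bary s - p] averages the differences [p' - p], and the one with [p' = p] vanishes. *)
Lemma bary_dist s p d l : p \in s -> diam_le d s ->
  `|bary s 0 l - p 0 l| <= (1 - (size s)%:R^-1) * d.
Proof.
move=> ps sd; have s_gt0 : (0 < size s)%N by case: (s) ps.
have s_neq0 : (size s)%:R != 0 :> R by rewrite pnatr_eq0 -lt0n.
have -> : bary s 0 l - p 0 l =
    (size s)%:R^-1 * \sum_(p' <- rem p s) (p' 0 l - p 0 l).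
  rewrite baryE (perm_big _ (perm_to_rem ps)) big_cons /= sumrB.
  rewrite big_const_seq count_predT iter_addr_0 size_rem // mulrBr mulrDr.
  rewrite -[p 0 l *+ _]mulr_natl -subn1 natrB //.
  by field; rewrite s_neq0.
rewrite normrM ger0_norm ?invr_ge0 ?ler0n // ler_pdivrMl ?ltr0n //.
rewrite mulrA mulrBr divff // mulr1; apply: le_trans (ler_norm_sum _ _ _) _.
rewrite big_seq; apply: le_trans (_ : \sum_(i <- rem p s | i \in rem p s) d <= _).
  by apply: ler_sum => p' /mem_rem p's; apply: sd.
rewrite -big_seq big_const_seq count_predT iter_addr_0 size_rem //.
by rewrite -[d *+ _]mulr_natl -subn1 natrB.
Qed.

(** Distances to the apex are bounded by [bary_dist], all others by induction on a face. A fixed [N]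
    keeps the contraction factor the same for all faces. *)
Lemma sd_mesh (A : zmodType) (N : nat) (K : E -> Prop) s (phi : seq E -> A) d :
    bary_closed K -> {in s, forall p, K p} -> (size s <= N)%N -> diam_le d s ->
  sd phi s != 0 ->
  exists t, [/\ size t = size s, {in t, forall p, K p},
    diam_le ((1 - N%:R^-1) * d) t & phi t != 0].
Proof.
have [k] := ubnP (size s); elim: k => // k IHk in K s phi *.
move=> /ltnSE-sz Kb Ks sN sd.
have [/size0nil-> phi0|s_gt0] := posnP (size s); first by exists [::].
rewrite sd_rec // => /cobd_neq0[t [st ts]].
set b := bary s; set e := _ * d.
(* For [n = 0] there are no coordinates and [diam_le] does not bound [d] from below. *)
have d_ge0 : (0 < n)%N -> 0 <= d.
  case: (s) s_gt0 sd => // p s' _ sd n_gt0.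
  have l := Ordinal n_gt0.
  by apply: le_trans (sd p p _ _ l); rewrite ?subrr ?normr0 ?mem_head.
have qle : (0 < n)%N -> (1 - (size s)%:R^-1) * d <= e.
  move=> n_gt0; apply: ler_wpM2r; first exact: d_ge0.
  by rewrite lerB // lef_pV2 ?posrE ?ltr0n ?ler_nat ?(leq_trans s_gt0).
have n0 (l : 'I_n) : (0 < n)%N by apply: leq_ltn_trans (ltn_ord l).
have bs p : p \in s -> forall l, `|b 0 l - p 0 l| <= e.
  by move=> ps l; apply: le_trans (bary_dist l ps sd) (qle (n0 l)).
(* The induction runs with [K] strengthened by closeness to the apex, so that the simplex found in
   the face can be coned off. *)
pose K' p := K p /\ forall l, `|b 0 l - p 0 l| <= e.
have K'b : bary_closed K'.
  move=> u u0 K'u; split; first by apply: Kb => // p /K'u[].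
  by apply: bary_closed_ball => // p /K'u[].
move=> /(IHk K')[|//||||u [su K'u du phiu]].
- by rewrite st.
- by move=> p /ts ps; split; [exact: Ks | exact: bs].
- by rewrite (leq_trans _ sN) // -st.
- by move=> p p' /ts ps /ts p's; apply: sd.
exists (b :: u); split; rewrite //= ?su //.
  by move=> p; rewrite inE => /predU1P[->|/K'u[]//]; apply: Kb.
move=> p p'; rewrite !inE => /predU1P[->|pu] /predU1P[->|p'u] l.
- rewrite subrr normr0 mulr_ge0 ?d_ge0 ?(n0 l) // subr_ge0 invf_le1 ?ltr0n ?ler1n;
  exact: leq_trans sN.
- by have [_] := K'u _ p'u.
- by rewrite distrC; have [_] := K'u _ pu.
- exact: du.
Qed.

End Coordinates.

(** * Sperner's lemma *)

Section SmallSimplex.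
Variables (R : realType) (n : nat).
Local Notation E := 'rV[R]_n.
Implicit Types (s t : seq E) (phi : seq E -> R).

Lemma bary_closed_std_simplex : bary_closed (@in_std_simplex R n).
Proof.
move=> s s0 sK; split=> [j|].
  by apply: bary_coord_ge => // p /sK[].
under eq_bigr do rewrite baryE.
rewrite -mulr_sumr exchange_big /= (eq_big_seq (fun=> 1)); last by move=> p /sK[].
by rewrite big_const_seq count_predT iter_addr_0 mulVf // pnatr_eq0 -lt0n.
Qed.

Definition in_facet (j : 'I_n) (p : E) := in_std_simplex p /\ p 0 j = 0.

Lemma bary_closed_facet j : bary_closed (in_facet j).
Proof.
move=> s s0 sK; split; first by apply: bary_closed_std_simplex => // p /sK[].
by apply: bary_closed_coord0 => // p /sK[].
Qed.

Definition vertices : seq E := [seq delta_mx 0 j | j <- enum 'I_n].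

Lemma size_vertices : size vertices = n.
Proof. by rewrite size_map size_enum_ord. Qed.

Lemma nth_vertices (j : 'I_n) : nth 0 vertices j = delta_mx 0 j.
Proof. by rewrite (nth_map j) ?size_enum_ord // nth_ord_enum. Qed.

Lemma in_std_simplex_vertices : {in vertices, forall p, in_std_simplex p}.
Proof.
move=> _ /mapP[j _ ->]; split=> [i|]; first by rewrite mxE ler0n.
rewrite (bigD1 j) //= mxE !eqxx big1 ?addr0 // => i ij.
by rewrite mxE (negPf ij) andbF.
Qed.

Lemma diam_vertices : diam_le 1 vertices.
Proof.
move=> _ _ /mapP[i _ ->] /mapP[j _ ->] l; rewrite !mxE.
by do 2 case: (_ && _); rewrite ?subrr ?subr0 ?sub0r ?normrN ?normr0 ?normr1.
Qed.

Definition rel_cocycle phi :=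
  (forall s, size s = n.+1 -> cobd s phi = 0) /\
  (forall j t, size t = n -> {in t, forall p, in_facet j p} -> phi t = 0).

(** Some vertex is missing, and all the others lie on the facet opposite to it. *)
Lemma facet_vertices t : {subset t <= vertices} -> (size t < n)%N ->
  exists j, {in t, forall p, in_facet j p}.
Proof.
move=> tv szt; have [j jt|all_in] := pickP (fun j => delta_mx 0 j \notin t).
  exists j => p pt; split; first exact/in_std_simplex_vertices/tv.
  have /mapP[i _ pE] := tv p pt; rewrite pE mxE eqxx /=.
  by case: eqP => // ji; rewrite ji -pE pt in jt.
have uv : uniq vertices.
  rewrite map_inj_uniq ?enum_uniq // => i j /matrixP/(_ 0 i).
  by rewrite !mxE !eqxx /=; case: eqP => // _ /eqP; rewrite oner_eq0.
have /(uniq_leq_size uv) : {subset vertices <= t}.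
  by move=> _ /mapP[j _ ->]; have /negbFE := all_in j.
by rewrite size_vertices leqNgt szt.
Qed.

(** On [vertices] both terms of the homotopy vanish: the first by the cocycle condition, the second
    because the homotopy on a proper face stays within a facet. *)
Lemma sd_rel_cocycle phi : rel_cocycle phi ->
  rel_cocycle (sd phi) /\ sd phi vertices = phi vertices.
Proof.
move=> [cophi bphi]; split; first split.
- move=> s szs; rewrite -sd_cobd; apply/eqP/negPn/negP.
  move=> /(@sd_neq0 _ _ _ (fun=> True))[//|//|t [szt _]].
  by rewrite cophi ?eqxx // szt.
- move=> j t szt tj; apply/eqP/negPn/negP.
  move=> /(sd_neq0 (@bary_closed_facet j) tj)[u [szu uj]].
  by rewrite (bphi j) ?eqxx // szu.
apply/esym/eqP; rewrite -subr_eq0 sd_homotopy.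
rewrite [X in X + _](_ : _ = 0) ?add0r; last first.
  apply/eqP/negPn/negP => /(@th_neq0 _ _ _ (fun=> True))[//|//|t [szt _]].
  by rewrite cophi ?eqxx // szt size_vertices.
apply/negPn/negP => /cobd_neq0[t [szt /facet_vertices tv]].
rewrite size_vertices in szt; have [|j tj] := tv; first by rewrite szt.
move=> /(th_neq0 (@bary_closed_facet j) tj)[u [szu uj]].
by rewrite (bphi j) ?eqxx // szu.
Qed.

Lemma small_simplex phi r : rel_cocycle phi -> phi vertices != 0 ->
  exists t, [/\ size t = n, {in t, forall p, in_std_simplex p},
    diam_le ((1 - n%:R^-1) ^+ r) t & phi t != 0].
Proof.
move=> cphi phi0.
have [_] : rel_cocycle (iter r (@sd R E R) phi) /\
    iter r (@sd R E R) phi vertices != 0.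
  elim: r => //= r [cr r0]; have [csr sr] := sd_rel_cocycle cr.
  by rewrite sr.
rewrite -[X in diam_le X]mulr1.
(* Generalized over the starting simplex: removing one [sd] replaces [s] by a smaller simplex. *)
suff: forall s d, size s = n -> {in s, forall p, in_std_simplex p} ->
    diam_le d s -> iter r (@sd R E R) phi s != 0 ->
    exists t, [/\ size t = n, {in t, forall p, in_std_simplex p},
      diam_le ((1 - n%:R^-1) ^+ r * d) t & phi t != 0].
  apply; [exact: size_vertices | exact: in_std_simplex_vertices |].
  exact: diam_vertices.
elim: r => [|r IHr] s d szs sK sd /=.
  by move=> s0; exists s; rewrite expr0 mul1r.
move=> /(sd_mesh bary_closed_std_simplex sK (eq_leq szs) sd).
move=> [t [szt tK td t0]]; rewrite exprSr -mulrA.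
by apply: IHr tK td t0; rewrite szt.
Qed.

(** * The label determinant as a relative cocycle *)

Variable L : E -> 'I_n.

(* A cocycle because the points [e_(L t_i)] lie on an affine hyperplane. *)
Definition label_det t : R :=
  \det (\matrix_(i < n, j < n) (L (nth 0 t i) == j)%:R).

Lemma label_det_missing t (j : 'I_n) :
  (forall i : 'I_n, L (nth 0 t i) != j) -> label_det t = 0.
Proof.
move=> tj; rewrite /label_det (expand_det_col _ j) big1 // => i _.
by rewrite mxE (negPf (tj i)) mul0r.
Qed.

Lemma cobd_label_det s : size s = n.+1 -> cobd s label_det = 0.
Proof.
move=> szs.
(* Label vectors with a column of ones in front; expanding along that column gives the
   coboundary. *)
pose M : 'M[R]_n.+1 := \matrix_(i, j)
  if unlift ord0 j is Some j' then (L (nth 0 s i) == j')%:R else 1.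
have detM : \det M = 0.
  apply/eqP; rewrite -det_tr; apply/det0P.
  (* The column of ones is the sum of the other columns. *)
  exists (\row_j if unlift ord0 j is Some _ then 1 else -1).
    apply/eqP => /rowP/(_ ord0); rewrite !mxE unlift_none => /eqP.
    by rewrite oppr_eq0 oner_eq0.
  apply/rowP => i; rewrite !mxE big_ord_recl !mxE unlift_none mulN1r.
  rewrite (bigD1 (L (nth 0 s i))) //= !mxE liftK eqxx mul1r big1 ?addr0 ?addNr //.
  by move=> j /negPf; rewrite !mxE liftK eq_sym => ->; rewrite mulr0.
rewrite cobdE; transitivity (\det M) => //.
rewrite (expand_det_col _ ord0) szs; apply: eq_bigr => i _.
rewrite mxE unlift_none mul1r /cofactor addn0; congr (_ * \det _).
apply/matrixP => k j; rewrite !mxE liftK nth_cat size_takel; last first.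
  by rewrite szs ltnW.
rewrite /= /bump; case: ltnP => ki.
  by rewrite nth_take ?add0n //.
by rewrite nth_drop add1n addSn subnKC.
Qed.

Hypothesis L_supp : forall p, in_std_simplex p -> p 0 (L p) != 0.

(** Label [j] does not occur on the facet [j], so the determinant has a zero column there. *)
Lemma rel_cocycle_label_det : rel_cocycle label_det.
Proof.
split=> [s|j t szt tj]; first exact: cobd_label_det.
apply: (@label_det_missing _ j) => i.
have [|ti /eqP] := tj (nth 0 t i); first by rewrite mem_nth // szt.
by apply: contraL => /eqP <-; apply: L_supp.
Qed.

Lemma label_det_vertices : label_det vertices = 1.
Proof.
rewrite /label_det -[RHS](det1 R n); congr (\det _).
apply/matrixP => i j; rewrite !mxE nth_vertices.
have -> : L (delta_mx 0 i) = i; last exact: erefl.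
have := L_supp (in_std_simplex_vertices (map_f _ (mem_enum _ i))).
rewrite mxE eqxx /=.
by case: (L _ =P i) => // _; rewrite eqxx.
Qed.

(** A nonzero label determinant has no zero column, so all labels occur on the small simplex. *)
Lemma sperner_small (r : nat) : exists q : 'I_n -> E,
  [/\ forall j, in_std_simplex (q j), forall j, L (q j) = j &
    forall i j l, `|q i 0 l - q j 0 l| <= (1 - n%:R^-1) ^+ r].
Proof.
have [|t [szt tK td t0]] := small_simplex r rel_cocycle_label_det.
  by rewrite label_det_vertices oner_eq0.
have tin (i : 'I_n) : nth 0 t i \in t by rewrite mem_nth // szt.
have Ltj j : exists i : 'I_n, L (nth 0 t i) == j.
  have [i Li|noi] := pickP (fun i : 'I_n => L (nth 0 t i) == j); first by exists i.
  by case/eqP: t0; apply: (@label_det_missing _ j) => i; rewrite noi.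
exists (fun j => nth 0 t (xchoose (Ltj j))); split=> [j|j|i j l].
- exact/tK/tin.
- exact/eqP/(xchooseP (Ltj j)).
- exact: td.
Qed.

End SmallSimplex.

(** * Surjectivity of face-preserving piecewise linear maps *)

Section Compactness.
Variables (R : realType) (I : finType).
Local Open Scope classical_set_scope.
Import numFieldNormedType.Exports.

Lemma continuous_linear_form (a : I -> R) :
  continuous (fun p : prod_topology (fun _ : I => R) => \sum_i a i * p i).
Proof.
apply: continuous_big => [|i _ p]; first exact: add_continuous.
have ci := @proj_continuous I (fun=> R) i p.
exact: (continuous_comp ci (@mulrl_continuous R (a i) (p i))).
Qed.

(** [p] is a cluster point given by Tychonoff's theorem. One [p] serves all linear inequalities at
    once. *)
Lemma box_cluster (u : nat -> I -> R) : (forall r i, 0 <= u r i <= 1) ->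
  exists p : I -> R, forall (a : I -> R) b,
    (forall r, \sum_i a i * u r i <= b + r.+1%:R^-1) ->
    \sum_i a i * p i <= b.
Proof.
move=> u01.
have /(_ (u @ \oo) _) := @tychonoff I (fun=> R) (fun=> `[0, 1]%classic)
  (fun=> @segment_compact R 0 1).
case=> [|p [_ clp]].
  by exists 0%N => // r _ i; rewrite /= in_itv /= u01.
exists p => a b uab; rewrite leNgt; apply/negP => bp.
pose g (q : prod_topology (fun _ : I => R)) := \sum_i a i * q i.
pose e := (g p - b) / 2.
have e_gt0 : 0 < e by rewrite divr_gt0 // subr_gt0.
have gp : \forall q \near (p : prod_topology (fun _ : I => R)), b + e < g q.
  have : g q @[q --> (p : prod_topology (fun _ : I => R))] --> g p.
    exact: continuous_linear_form.
  move=> /cvgr_gt; apply.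
  by rewrite /e; move: bp; rewrite -/(g p); lra.
have ue : (u @ \oo) [set q | g q < b + e].
  have : \forall r \near \oo, r.+1%:R^-1 < e.
    exact: near_infty_natSinv_lt (PosNum e_gt0).
  apply: filterS => r re /=; apply: le_lt_trans (uab r) _.
  by rewrite ltrD2l.
have [q [/= q1 q2]] := clp _ _ ue gp.
by have := lt_trans q1 q2; rewrite ltxx.
Qed.

Lemma expr_small (q e : R) : 0 <= q < 1 -> 0 < e -> exists k, q ^+ k <= e.
Proof.
move=> /andP[q0 q1] e0.
have /cvg_expr : `|q| < 1 by rewrite ger0_norm.
move=> /cvgr_lt/(_ e e0)[k _ /(_ k (leqnn _)) /= /ltW qk].
by exists k.
Qed.

End Compactness.

Lemma eq_of_le_sum (R : realDomainType) (I : finType) (a b : I -> R) :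
  (forall i, a i <= b i) -> \sum_i a i = \sum_i b i -> forall i, a i = b i.
Proof.
move=> ab sab i; apply/eqP; rewrite eq_sym -subr_eq0; apply/eqP.
apply: (psumr_eq0P (P := predT) (F := fun i => b i - a i)) => //.
  by move=> j _; rewrite subr_ge0.
by rewrite sumrB sab subrr.
Qed.

Lemma convex_coef_unique (R : realType) (n : nat) (V : finType)
    (pos : V -> 'rV[R]_n) (s : {set V}) (c d : V -> R) :
  affinely_indep pos s ->
  (forall v, v \notin s -> c v = 0) -> (forall v, v \notin s -> d v = 0) ->
  \sum_v c v = \sum_v d v -> \sum_v c v *: pos v = \sum_v d v *: pos v ->
  c =1 d.
Proof.
move=> indep cs ds scd scdp v; apply/eqP; rewrite -subr_eq0; apply/eqP.
apply: (indep (fun v => c v - d v)).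
- by move=> w ws; rewrite cs ?ds ?subrr.
- by rewrite sumrB scd subrr.
- by under eq_bigr do rewrite scalerBl; rewrite sumrB scdp subrr.
Qed.

(** * Passing to the limit of witnesses *)

Section Surjectivity.
Variables (R : realType) (n : nat) (V : finType).
Variables (pos : V -> 'rV[R]_n) (T : {set {set V}}) (f : V -> 'I_n -> R).
Variable y : 'I_n -> R.
Hypotheses (n_gt0 : (0 < n)%N) (tri : is_triangulation pos T).
Hypothesis sum_f : forall v, \sum_j f v j = 1.
Hypothesis f_face : forall v j, pos v 0 j = 0 -> f v j = 0.
Hypotheses (y_ge0 : forall j, 0 <= y j) (sum_y : \sum_j y j = 1).

Let sum_pl (c : V -> R) : \sum_v c v = 1 -> \sum_j \sum_v c v * f v j = 1.
Proof.
move=> <-; rewrite exchange_big; apply: eq_bigr => v _.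
by rewrite -mulr_sumr sum_f mulr1.
Qed.

(* [(s, c)] are a supporting simplex and barycentric coordinates of [p], whose
   image under the piecewise linear extension of [f] has [j]-th coordinate at
   least [y j]. *)
Definition witness p j (s : {set V}) (c : V -> R) :=
  [/\ s \in T, forall v, 0 <= c v, forall v, v \notin s -> c v = 0,
      \sum_v c v = 1 & p = \sum_v c v *: pos v /\ y j <= \sum_v c v * f v j].

(** Otherwise the image of [p] is at most [y] in every coordinate and strictly below it on the
    support of [p], although both have coordinate sum 1. *)
Lemma witness_exists p : in_std_simplex p ->
  exists j, p 0 j != 0 /\ exists s c, witness p j s c.
Proof.
case: tri => [_ [posD [_ [_ [_ [cover _]]]]]] pD.
have [s sT [c [c_ge0 cs c1 pE]]] := cover p pD.
have [j /andP[pj yj]|nolab] :=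
    pickP (fun j => (p 0 j != 0) && (y j <= \sum_v c v * f v j)).
  by exists j; split=> //; exists s, c.
have Fy j : \sum_v c v * f v j <= y j.
  (* Off the support of [p], every [v] of nonzero weight has [j]-th coordinate 0, so [f_face] makes
     the image coordinate 0. *)
  have [pj0|pj] := eqVneq (p 0 j) 0; last first.
    by have := nolab j; rewrite pj /= => /negbT; rewrite -ltNge => /ltW.
  rewrite big1 // => v _; have : \sum_v c v * pos v 0 j = 0.
    by transitivity (p 0 j) => //; rewrite pE summxE; apply: eq_bigr => w _; rewrite mxE.
  move=> /(psumr_eq0P (fun w _ => mulr_ge0 (c_ge0 w) ((posD w).1 j)))/(_ v isT).
  by move/eqP; rewrite mulf_eq0 => /orP[/eqP->|/eqP/f_face->]; rewrite ?mul0r ?mulr0.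
have [j pj] : exists j, p 0 j != 0.
  apply/existsP; apply: contraT; rewrite negb_exists => /forallP p0.
  have := pD.2; rewrite big1; first by move/eqP; rewrite eq_sym oner_eq0.
  by move=> j _; apply/eqP/negPn.
have := nolab j; rewrite pj (eq_of_le_sum Fy) ?lexx //.
by rewrite sum_pl.
Qed.

(** One witness per label, pairwise close in every coordinate. The simplices [S] range over a finite
    type, for the pigeonhole, and all weights form one point of a cube, for compactness. *)
Definition approx (r : nat) (S : {ffun 'I_n -> {set V}}) (c : 'I_n * V -> R) :=
  (forall j, exists p, witness p j (S j) (fun v => c (j, v))) /\
  forall i j l, \sum_v c (i, v) * pos v 0 l <=
                \sum_v c (j, v) * pos v 0 l + r.+1%:R^-1.

Lemma approx_exists r : exists S c, approx r S c.
Proof.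
have /choice[L LP] (p : 'rV[R]_n) : exists j, in_std_simplex p ->
    p 0 j != 0 /\ exists s c, witness p j s c.
  have [/witness_exists[j pj]|npD] := pselect (in_std_simplex p); first by exists j.
  (* An arbitrary label outside the simplex. *)
  by exists (Ordinal n_gt0).
have [||k qk] := @expr_small R (1 - n%:R^-1) r.+1%:R^-1.
- by rewrite subr_ge0 invf_le1 ?ltr0n // ler1n n_gt0 gtrBl invr_gt0 ltr0n.
- by rewrite invr_gt0 ltr0n.
have [q [qD Lq q_close]] := sperner_small (fun p pD => (LP p pD).1) k.
have wq j : exists sc, witness (q j) j sc.1 sc.2.
  by have [_ [s [c w]]] := LP _ (qD j); exists (s, c); rewrite Lq in w.
have [sc scP] := choice wq.
exists [ffun j => (sc j).1], (fun jv => (sc jv.1).2 jv.2).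
split=> [j|i j l]; first by exists (q j); rewrite ffunE.
have qE j' : q j' 0 l = \sum_v (sc j').2 v * pos v 0 l.
  have [_ _ _ _ [-> _]] := scP j'.
  by rewrite summxE; apply: eq_bigr => v _; rewrite mxE.
rewrite /= -!qE -lerBlDl; apply: le_trans qk.
by apply: le_trans (ler_norm _) (q_close i j l).
Qed.

Lemma approx_le r r' S c : (r <= r')%N -> approx r' S c -> approx r S c.
Proof.
move=> rr' [w close]; split=> // i j l; apply: le_trans (close i j l) _.
by rewrite lerD2l lef_pV2 ?posrE ?ltr0n // ler_nat ltnS.
Qed.

(** If every [S] failed at some accuracy, the maximum of these finitely many accuracies would
    contradict [approx_exists]. *)
Lemma approx_pigeonhole : exists S, forall r, exists c, approx r S c.
Proof.
apply: contrapT => /forallNP noS.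
have /choice[rS rSP] S : exists r, forall c, ~ approx r S c.
  by have /existsNP[r /forallNP rP] := noS S; exists r.
have [S [c Sc]] := approx_exists (\max_S rS S).
by apply: (rSP S c); apply: approx_le Sc; apply: leq_bigmax.
Qed.

Lemma pl_surjective : exists2 s, s \in T & exists c : V -> R,
  [/\ forall v, 0 <= c v, forall v, v \notin s -> c v = 0,
      \sum_v c v = 1 & forall j, \sum_v c v * f v j = y j].
Proof.
have [S /choice[u uP]] := approx_pigeonhole.
have wu r j : [/\ S j \in T, forall v, 0 <= u r (j, v),
    forall v, v \notin S j -> u r (j, v) = 0, \sum_v u r (j, v) = 1 &
    y j <= \sum_v u r (j, v) * f v j].
  by have [q [? ? ? ? [_ ?]]] := (uP r).1 j.
have [|p pP] := @box_cluster R _ u.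
  move=> r [j v]; have [_ u0 _ u1 _] := wu r j.
  by rewrite u0 -u1 (bigD1 v) //= lerDl sumr_ge0.
(* Writes a linear form in the [j]-th weights as one in all the weights, as [box_cluster]
   requires. *)
have row (c : 'I_n * V -> R) j (g : V -> R) :
    \sum_i ((i.1 == j)%:R * g i.2) * c i = \sum_v c (j, v) * g v.
  transitivity (\sum_j' \sum_v (j' == j)%:R * g v * c (j', v)).
    by rewrite pair_bigA; apply: eq_bigr => -[].
  rewrite (bigD1 j) //= eqxx [X in _ + X]big1 ?addr0.
    by apply: eq_bigr => v _; rewrite mul1r mulrC.
  by move=> j' /negPf->; apply: big1 => v _; rewrite !mul0r.
have inv_ge0 r : 0 <= r.+1%:R^-1 :> R by rewrite invr_ge0 ler0n.
have le_p j g b : (forall r, \sum_v u r (j, v) * g v <= b) ->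
    \sum_v p (j, v) * g v <= b.
  move=> ub; rewrite -row; apply: pP => r.
  by rewrite row (le_trans (ub r)) // lerDl.
have eq_p j g b : (forall r, \sum_v u r (j, v) * g v = b) ->
    \sum_v p (j, v) * g v = b.
  move=> ub; apply/eqP; rewrite eq_le le_p => [|r]; last by rewrite ub.
  rewrite -lerN2 -sumrN; under eq_bigr do rewrite -mulrN.
  apply: le_p => r; under eq_bigr do rewrite mulrN.
  by rewrite sumrN ub.
have delta (c : 'I_n * V -> R) j v : \sum_w c (j, w) * (w == v)%:R = c (j, v).
  rewrite (bigD1 v) //= eqxx mulr1 big1 ?addr0 // => w /negPf->.
  by rewrite mulr0.
have p_ge0 j v : 0 <= p (j, v).
  rewrite -oppr_le0 -delta -sumrN; under eq_bigr do rewrite -mulrN.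
  apply: le_p => r; under eq_bigr do rewrite mulrN.
  by rewrite sumrN delta oppr_le0; have [] := wu r j.
have p_supp j v : v \notin S j -> p (j, v) = 0.
  move=> vS; rewrite -delta; apply: eq_p => r; rewrite delta.
  by have [_ _ /(_ v vS)] := wu r j.
have p_sum j : \sum_v p (j, v) = 1.
  under eq_bigr do rewrite -[p _]mulr1.
  apply: eq_p => r; under eq_bigr do rewrite mulr1.
  by have [] := wu r j.
have p_y j : y j <= \sum_v p (j, v) * f v j.
  rewrite -lerN2 -sumrN; under eq_bigr do rewrite -mulrN.
  apply: le_p => r; under eq_bigr do rewrite mulrN.
  by rewrite sumrN lerN2; have [] := wu r j.
pose x j := \sum_v p (j, v) *: pos v.
(* The gap between the [i]-th and [j]-th points tends to 0; by symmetry all limit points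
   coincide. *)
have x_le i j l : x i 0 l <= x j 0 l.
  pose g v := pos v 0 l.
  have xE k : x k 0 l = \sum_i ((i.1 == k)%:R * g i.2) * p i.
    by rewrite row summxE; apply: eq_bigr => v _; rewrite mxE.
  rewrite -subr_le0 !xE -sumrB; under eq_bigr do rewrite -mulrBl.
  apply: pP => r; under eq_bigr do rewrite mulrBl.
  by rewrite sumrB !(row (u r)) add0r lerBlDl; apply: (uP r).2.
pose j0 := Ordinal n_gt0.
have x_eq j : x j = x j0 by apply/rowP => l; apply: le_anti; rewrite !x_le.
have ST j : S j \in T by have [] := wu 0%N j.
case: tri => [_ [_ [_ [simplex [_ [_ inter]]]]]].
(* The common limit lies in [S j] and [S j0], hence in their intersection; uniqueness of barycentric
   coordinates identifies both weight systems with the one found there. *)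
have p_eq j v : p (j, v) = p (j0, v).
  have conv i : in_conv pos (S i) (x j0).
    by rewrite -(x_eq i); exists (fun v => p (i, v)); split=> //; exact: p_supp.
  have [d [_ ds d1 xd]] := inter _ _ _ (ST j) (ST j0) (conv j) (conv j0).
  have coef i : (forall v, v \notin S i -> d v = 0) -> forall v, p (i, v) = d v.
    move=> di.
    apply: (convex_coef_unique (simplex _ (ST i)).2 (p_supp i) di).
      by rewrite p_sum.
    by rewrite -xd -(x_eq i).
  by rewrite !coef // => w wS; apply: ds; rewrite inE (negPf wS) ?andbF.
exists (S j0) => //; exists (fun v => p (j0, v)); split=> // [|j]; first exact: p_supp.
(* The image dominates [y] coordinatewise, and both sum to 1. *)
apply: esym; apply: (eq_of_le_sum (a := y) (b := fun i => \sum_v p (j0, v) * f v i)).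
  by move=> i; under eq_bigr do rewrite -(p_eq i); apply: p_y.
by rewrite sum_y sum_pl.
Qed.

End Surjectivity.

(** * Counting labels *)

(** If that coordinate were 0, the vertex would lie in the facet omitting its own label. *)
Lemma sperner_label_support (R : realType) (n : nat) (V : finType)
    (pos : V -> 'rV[R]_n) (lam : V -> 'I_n) v :
  in_std_simplex (pos v) -> sperner_labeling pos lam -> pos v 0 (lam v) != 0.
Proof.
move=> [pos_ge0 pos1] sp; apply/eqP => pos0.
suff /(sp v) : in_face [set~ lam v] (pos v) by rewrite !inE eqxx.
exists (pos v 0); split=> //; last exact: row_sum_delta.
by move=> j; rewrite !inE negbK => /eqP->.
Qed.

Lemma leq_card_of_sum (R : numDomainType) (I : finType) (A : {set I})
    (x : I -> R) (k : nat) :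
  (forall i, x i <= 1) -> (forall i, i \notin A -> x i = 0) ->
  k%:R - 1 < \sum_i x i -> (k <= #|A|)%N.
Proof.
move=> x1 xA /lt_le_trans-/(_ #|A|%:R).
rewrite ltrBlDr natr1 ltr_nat ltnS; apply.
rewrite -sumr_const [leRHS]big_mkcond /=; apply: ler_sum => i _.
by case: ifPn => [_|/xA->].
Qed.

(** The shift [1/n] spreads the surplus of one evenly: the total is exactly [m], yet each term
    exceeds [l j - 1]. *)
Lemma sum_shift (R : numFieldType) (n m : nat) (l : 'I_n -> nat) :
  (0 < n)%N -> (\sum_j l j)%N = (m + n - 1)%N ->
  \sum_j ((l j)%:R - 1 + n%:R^-1) = m%:R :> R.
Proof.
move=> n_gt0 suml; rewrite big_split sumrB /= -natr_sum suml.
rewrite !sumr_const card_ord -[_^-1 *+ n]mulr_natr mulVf ?pnatr_eq0 -?lt0n //.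
by rewrite -addnBA // subn1 natrD -subn1 natrB //; ring.
Qed.

(** * Simplices from weighted labelings *)

Section WeightedLabelings.
Variables (R : realType) (n m : nat) (V : finType).
Variables (pos : V -> 'rV[R]_n) (T : {set {set V}}) (lam : 'I_m -> V -> 'I_n).
Hypotheses (n_gt0 : (0 < n)%N) (tri : is_triangulation pos T).
Hypothesis sperner_lam : forall i, sperner_labeling pos (lam i).

(* [X i] are the barycentric coordinates of the image of a point of [s] under
   the piecewise linear extension of [lam i]. *)
Lemma weighted_labels (w : 'I_m -> R) (y : 'I_n -> R) :
  \sum_i w i = 1 ->
  (forall j, 0 <= y j) -> \sum_j y j = 1 ->
  exists2 s, s \in T & exists X : 'I_m -> 'I_n -> R,
    [/\ forall i j, 0 <= X i j, forall i, \sum_j X i j = 1,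
        forall i j, ~~ [exists v in s, lam i v == j] -> X i j = 0 &
        forall j, \sum_i w i * X i j = y j].
Proof.
move=> w1 y_ge0 y1.
have sum_label i v : \sum_j (lam i v == j)%:R = 1 :> R.
  rewrite (bigD1 (lam i v)) //= eqxx big1 ?addr0 // => j.
  by rewrite eq_sym => /negPf->.
have [||||s sT [c [c_ge0 cs c1 cy]]] :=
  @pl_surjective R n V pos T (fun v j => \sum_i w i * (lam i v == j)%:R) y n_gt0 tri.
- move=> v; rewrite exchange_big -[RHS]w1; apply: eq_bigr => i _.
  by rewrite -mulr_sumr sum_label mulr1.
- move=> v j pos0; apply: big1 => i _; case: eqP => [lj|_]; last by rewrite mulr0.
  have := sperner_label_support (tri.2.1 v) (sperner_lam i).
  by rewrite lj pos0 eqxx.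
- exact: y_ge0.
- exact: y1.
exists s => //; exists (fun i j => \sum_v c v * (lam i v == j)%:R); split.
- by move=> i j; apply: sumr_ge0 => v _; rewrite mulr_ge0 ?ler0n.
- move=> i; rewrite exchange_big -[RHS]c1; apply: eq_bigr => v _.
  by rewrite -mulr_sumr sum_label mulr1.
- move=> i j /exists_inPn noj; apply: big1 => v _.
  have [/noj/negPf->|/cs->] := boolP (v \in s); by rewrite ?mulr0 ?mul0r.
move=> j; rewrite -cy; under eq_bigr do rewrite mulr_sumr.
rewrite exchange_big; apply: eq_bigr => v _; rewrite mulr_sumr.
by apply: eq_bigr => i _; rewrite mulrCA.
Qed.

Lemma sum_div (I : finType) (x : I -> R) (k : nat) : (0 < k)%N ->
  \sum_i x i = k%:R -> \sum_i x i / k%:R = 1.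
Proof. by move=> k0 sx; rewrite -mulr_suml sx divff // pnatr_eq0 -lt0n. Qed.

(** Weights [r i / n] and the barycenter as target: the matrix [r i * X i j] has column sums 1, so
    entries at most 1, and row sums [r i > k i - 1]. *)
Lemma many_labels (k : 'I_m -> nat) : (0 < m)%N -> (forall i, 0 < k i)%N ->
  (\sum_(i < m) k i)%N = (m + n - 1)%N ->
  exists2 sigma, sigma \in T &
    forall i, (k i <= #|[set lam i v | v in sigma]|)%N.
Proof.
move=> m_gt0 k_gt0 sumk; have n_neq0 : n%:R != 0 :> R by rewrite pnatr_eq0 -lt0n.
pose r i : R := (k i)%:R - 1 + m%:R^-1.
have r_ge0 i : 0 <= r i by rewrite addr_ge0 ?subr_ge0 ?ler1n ?invr_ge0 ?ler0n.
have [|||s sT [X [X_ge0 X1 Xs Xy]]] :=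
  @weighted_labels (fun i => r i / n%:R) (fun=> 1 / n%:R).
- by apply: sum_div => //; apply: sum_shift; rewrite // addnC.
- by move=> j; rewrite divr_ge0 ?ler0n ?ler01.
- by apply: sum_div; rewrite // sumr_const card_ord.
exists s => // i; apply: (@leq_card_of_sum R _ _ (fun j => r i * X i j)).
- move=> j; have rX_ge0 i' : 0 <= r i' * X i' j by rewrite mulr_ge0.
  have <- : \sum_i' r i' * X i' j = 1.
    apply: (mulIf (invr_neq0 n_neq0)); rewrite -(Xy j) mulr_suml.
    by apply: eq_bigr => i' _; rewrite mulrAC.
  by rewrite (bigD1 i) //= lerDl sumr_ge0.
- move=> j jN; rewrite Xs ?mulr0 //; apply: contra jN => /exists_inP[v vs /eqP<-].
  exact: imset_f.
- by rewrite -mulr_sumr X1 mulr1 ltrDl invr_gt0 ltr0n.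
Qed.

Lemma popular_labels (l : 'I_n -> nat) : (0 < m)%N -> (forall j, 0 < l j)%N ->
  (\sum_(j < n) l j)%N = (m + n - 1)%N ->
  exists2 tau, tau \in T &
    forall j, (l j <= #|[set i : 'I_m | [exists v in tau, lam i v == j]]|)%N.
Proof.
move=> m_gt0 l_gt0 suml; have m_neq0 : m%:R != 0 :> R by rewrite pnatr_eq0 -lt0n.
pose r j : R := (l j)%:R - 1 + n%:R^-1.
have r_ge0 j : 0 <= r j by rewrite addr_ge0 ?subr_ge0 ?ler1n ?invr_ge0 ?ler0n.
have [|||s sT [X [X_ge0 X1 Xs Xy]]] :=
  @weighted_labels (fun=> 1 / m%:R) (fun j => r j / m%:R).
- by apply: sum_div; rewrite // sumr_const card_ord.
- by move=> j; rewrite divr_ge0 ?ler0n.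
- by apply: sum_div => //; apply: sum_shift.
exists s => // j; apply: (@leq_card_of_sum R _ _ (X^~ j)).
- by move=> i; rewrite -(X1 i) (bigD1 j) //= lerDl sumr_ge0.
- by move=> i; rewrite inE; apply: Xs.
have -> : \sum_i X i j = r j.
  apply: (mulIf (invr_neq0 m_neq0)); rewrite -(Xy j) mulr_suml.
  by apply: eq_bigr => i _; rewrite mul1r mulrC.
by rewrite ltrDl invr_gt0 ltr0n.
Qed.

End WeightedLabelings.

Theorem theorem2p1 (R : realType) (n m : nat) (V : finType)
    (pos : V -> 'rV[R]_n) (T : {set {set V}}) (lam : 'I_m -> V -> 'I_n) :
  (0 < n)%N ->
  is_triangulation pos T ->
  (forall i, sperner_labeling pos (lam i)) ->
  (forall k : 'I_m -> nat, (forall i, 0 < k i)%N ->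
     (\sum_(i < m) k i)%N = (m + n - 1)%N ->
     exists2 sigma, sigma \in T &
       forall i, (k i <= #|[set lam i v | v in sigma]|)%N)
  /\
  (forall l : 'I_n -> nat, (forall j, 0 < l j)%N ->
     (\sum_(j < n) l j)%N = (m + n - 1)%N ->
     exists2 tau, tau \in T &
       forall j, (l j <= #|[set i : 'I_m | [exists v in tau, lam i v == j]]|)%N).
Proof.
move=> n_gt0 tri sp; split=> [k pos_k sum_k|l pos_l sum_l]; have [m0|m_gt0] := posnP m.
(* For [m = 0] the claim on labelings is vacuous; a simplex is still needed, and one covering a
   vertex serves. *)
- have j := Ordinal n_gt0; have [_ [_ [_ [_ [_ [cover _]]]]]] := tri.
  have [s sT _] := cover _ (in_std_simplex_vertices (map_f _ (mem_enum 'I_n j))).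
  exists s => // i; have m_gt0 := leq_ltn_trans (leq0n i) (ltn_ord i).
  by exfalso; move: m_gt0; rewrite m0.
- exact: (many_labels n_gt0 tri sp m_gt0 pos_k sum_k).
(* For [m = 0], [n] positive integers cannot sum to [n - 1]. *)
- have : (\sum_(j < n) 1 <= \sum_(j < n) l j)%N by apply: leq_sum.
  rewrite sum_l sum1_card card_ord => n_le; exfalso; move: n_le.
  by rewrite m0 add0n subn1 leqNgt prednK ?leqnn.
- exact: (popular_labels n_gt0 tri sp m_gt0 pos_l sum_l).
Qed.
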